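(* Let $(S,\Sigma,\mu)$ be an atomless probability space, let $T$ be a nonempty topological space, and let $L(S,T)$ be the set of all functions from $S$ to $T$ with the topology of pointwise convergence. Let $F\subseteq L(S,T)$ and let $B\colon F\twoheadrightarrow F$ be a decomposable $\mu$-sequentially closed-graphed mapping. If for a nonempty compact and metrizable $X\subseteq F$ we have $X\cap B(f)\neq\emptyset$ for each $f\in F$, then $B$ has a fixed point.
   Context: $L(S,T)$ consists of all functions $S\to T$, not necessarily measurable, with the topology of pointwise convergence. A subset of $L(S,T)$ is metrizable if it is a metrizable topological space in the topology of pointwise convergence. For $E\in\Sigma$ and $f,g\in L(S,T)$, $g_Ef\in L(S,T)$ is the function with $g_Ef(s)=g(s)$ if $s\in E$ and $g_Ef(s)=f(s)$ if $s\in S\setminus E$. A subset $F\subseteq L(S,T)$ is decomposable if $g_Ef\in F$ for each $E\in\Sigma$ and $f,g\in F$. A set-valued (possibly empty valued) mapping $B\colon F\twoheadrightarrow F$ is a decomposable mapping if its domain $F$ and its values $B(f)$, for all $f\in F$, are decomposable subsets of $L(S,T)$. A decomposable mapping $B\colon F\twoheadrightarrow F$ is $\mu$-sequentially closed graphed if: (1) if $\mu(E)=0$ and $g\in B(f)$, then $h_Eg\in B(f)$ and $g\in B(h_Ef)$ for all $h\in F$; (2) $F$ is sequentially closed in $L(S,T)$; (3) $B$ has a sequentially closed graph in $F\times F$. A fixed point of $B$ is a function $f\in F$ with $f\in B(f)$. *)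

(* Defs.v *)
From HB Require Import structures.
From mathcomp Require Import all_boot all_order all_algebra.
From mathcomp Require Import all_classical all_reals all_analysis.
Set Implicit Arguments.
Unset Strict Implicit.
Unset Printing Implicit Defensive.
Import Order.TTheory GRing.Theory Num.Theory.
Local Open Scope classical_set_scope.
Local Open Scope ring_scope.

(* The space L(S,T) of all functions, with the topology of pointwise
   convergence, is {ptws S -> T}.  The function g_E f (g on E, f off E) is
   patch f E g. *)

Definition atomless (R : realType) (d : measure_display) (S : measurableType d)
    (mu : set S -> \bar R) : Prop :=
  forall A : set S, measurable A -> (0 < mu A)%E ->
    exists A' : set S,
      [/\ measurable A', A' `<=` A, (0 < mu A')%E & (mu A' < mu A)%E].

(* Nonnegativity of dist follows from the other axioms. *)
Definition metrizable (R : realType) (X : topologicalType) : Prop :=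
  exists dist : X -> X -> R,
    [/\ forall x y, dist x y = 0 <-> x = y,
        forall x y, dist x y = dist y x,
        forall x y z, dist x z <= dist x y + dist y z &
        forall (x : X) (V : set X),
          nbhs x V <-> exists2 e : R, 0 < e & [set y | dist x y < e] `<=` V].

(* A, a subset of Y, is sequentially closed in the subspace Y. *)
Definition seq_closed_in (U : topologicalType) (Y A : set U) : Prop :=
  forall (u : nat -> U) (l : U),
    (forall n, A (u n)) -> Y l -> u @ \oo --> l -> A l.

Definition decomposable (d : measure_display) (S : measurableType d)
    (T : topologicalType) (F : set {ptws S -> T}) : Prop :=
  forall (E : set S) (f g : {ptws S -> T}),
    measurable E -> F f -> F g -> F (patch f E g).

(* A possibly empty valued mapping from F to F is encoded as a total B, of
   which only the values at points of F are ever used. *)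
Definition decomposable_mapping (d : measure_display) (S : measurableType d)
    (T : topologicalType) (F : set {ptws S -> T})
    (B : {ptws S -> T} -> set {ptws S -> T}) : Prop :=
  [/\ decomposable F,
      forall f, F f -> B f `<=` F &
      forall f, F f -> decomposable (B f)].

Definition graph_on (U : Type) (F : set U) (B : U -> set U) : set (U * U) :=
  [set p | F p.1 /\ B p.1 p.2].

Definition mu_seq_closed_graphed (R : realType) (d : measure_display)
    (S : measurableType d) (mu : set S -> \bar R) (T : topologicalType)
    (F : set {ptws S -> T}) (B : {ptws S -> T} -> set {ptws S -> T}) : Prop :=
  [/\ forall (E : set S) (f g h : {ptws S -> T}),
        measurable E -> mu E = 0%E -> F f -> B f g -> F h ->
        B f (patch g E h) /\ B (patch f E h) g,
      seq_closed_in [set: {ptws S -> T}] F &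
      seq_closed_in (F `*` F) (graph_on F B)].

(* Main.v *)
Require Import Defs.
From HB Require Import structures.
From mathcomp Require Import all_boot all_order all_algebra.
From mathcomp Require Import lra zify.
Set Implicit Arguments.
Unset Strict Implicit.
Unset Printing Implicit Defensive.
Import Order.TTheory GRing.Theory Num.Theory.

(** By the Alexandroff-Hausdorff theorem [X] is the image of the Cantor space under
    a continuous map [q] ([cantor_parametrization]), and since [mu] is atomless
    there is a measurable [U : S -> [0, 1]] all of whose level sets are null
    ([diffuse_function]).  A probability [nu] on the Cantor space then defines a
    function [f_nu], up to a null set: with [c s] the [U s]-quantile of [nu] for the
    lexicographic order, [f_nu s = q (c s) s].  Off a null set this depends
    continuously on [nu], because weak convergence of measures implies convergence
    of quantiles.

    It suffices to find [nu] supported by the closed set of those [c] such that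
    [q c] belongs to [B f_nu].  Indeed [f_nu] is then, off a null set, a pointwise
    limit of functions which select, on the pieces of a finite measurable
    partition of [S], members of [B f_nu]; these functions belong to [B f_nu] by
    decomposability, hence so does [f_nu] because the graph of [B] is sequentially
    closed.

    Such a [nu] comes from a dual form of Sperner's lemma.  At level [n] consider
    the measures giving masses in multiples of [4 ^- n] to the [2 ^ n] cylinders of
    depth [n]; they define simple functions, thus members of [F] by
    decomposability, and each of them is labelled by a cylinder containing some [c]
    with [q c] in the corresponding value of [B].  The lemma, in the combinatorial
    form due to Scarf ([colorful_room], proved by a parity argument), gives a
    family of mutually close measures whose labels cover all the cylinders of
    noticeable mass ([sperner_thresholds]).  Measures are represented by the
    thresholds which delimit the cylinders in [0, 1]; a limit of the thresholds
    along a subsequence ([unit_cube_subseq]) defines [nu], and the labels converge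
    to the required points of the Cantor space ([decomposable_fixed_point]). *)

(** * Scarf's lemma *)

Section Scarf.
Context (T I : finType) (k : I -> T -> nat).
Hypothesis k_inj : forall i, injective (k i).
Implicit Types (A B : {set T + I}) (x y : T) (i l : I) (z : T + I).

(** A subset [B] of [T + I] stands for a pair: the points [x] with [inl x] in
    [B], and the active indices, those [i] with [inr i] outside [B].  It is
    dominant when every point of [T] is, for some active index [i], below all the
    points of [B] with respect to [k i].  With this encoding dominance is inherited
    by subsets, and the equality of the numbers of points and of active indices
    reads [#|B| = #|I|]. *)
Definition dominant B :=
  [forall y : T, exists i : I,
     (inr i \notin B) && [forall x : T, (inl x \in B) ==> (k i y <= k i x)]].

Lemma dominantP B :
  reflect (forall y, exists2 i, inr i \notin B &
             forall x, inl x \in B -> k i y <= k i x)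
          (dominant B).
Proof.
apply: (iffP forallP) => H y.
  have /existsP[i /andP[iB /forallP H']] := H y.
  by exists i => // x xB; have /implyP := H' x; apply.
have [i iB H'] := H y; apply/existsP; exists i; rewrite iB.
by apply/forallP => x; apply/implyP; exact: H'.
Qed.

Lemma dominantS A B : A \subset B -> dominant B -> dominant A.
Proof.
move=> /subsetP AB /dominantP domB; apply/dominantP => y.
have [i iB H] := domB y; exists i; first by apply: contra iB; exact: AB.
by move=> x /AB; exact: H.
Qed.

Definition points B := [set x | inl x \in B].
Definition active B := [set i | inr i \notin B].

Lemma card_points_active B : #|B| + #|active B| = #|points B| + #|I|.
Proof.
have -> : #|B| = #|points B| + #|(~: active B)%SET|.
  have <- : #|inl @: points B :|: inr @: (~: active B) : {set T + I}| = #|B|.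
    apply: eq_card => -[x|i]; rewrite inE.
      rewrite mem_imset ?inE; last by move=> ? ? [].
      by case: imsetP => [[? _ //]|_]; rewrite orbF.
    rewrite orbC mem_imset ?inE ?negbK; last by move=> ? ? [].
    by case: imsetP => [[? _ //]|_]; rewrite orbF.
  rewrite cardsU disjoint_setI0; last first.
    apply/pred0P => -[x|i] /=; apply/negP => /andP[].
      by move=> _ /imsetP[].
    by move=> /imsetP[].
  by rewrite cards0 subn0 !card_imset// => ? ? [].
by rewrite -addnA [#|~: _| + _]addnC cardsC.
Qed.

(** The elements that can be added to [B] without losing dominance.  Dominant sets
    of cardinal [#|I|] are called rooms, and dominant sets with one element less
    are called doors. *)
Definition room_completions B := [set z | (z \notin B) && dominant (z |: B)].

(** A door containing a point lies in exactly two rooms.  Sending an active index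
    [l] to the [k l]-smallest point [mn l] of [B] maps the active indices onto the
    points, and there is one more index than points, so exactly two indices [i]
    and [j] collide.  Each of them yields one room: let [M l] be the set of points
    above [mn l'] for every active [l'] other than [l]; if [M l] is empty then [l]
    can be deactivated, otherwise the [k l]-largest point of [M l] can be added. *)
Lemma card_room_completions_door B :
  dominant B -> #|B|.+1 = #|I| -> points B != set0 ->
  #|room_completions B| = 2.
Proof.
move=> domB cardB /set0Pn[x0 x0B].
set P := points B; set C := active B.
have cardC : #|C| = #|P|.+1.
  by move: (card_points_active B); rewrite -/P -/C; lia.
pose mn i := [arg min_(x < x0 in P) k i x].
have mnP i : mn i \in P by rewrite /mn; case: arg_minnP.
have mn_le i x : x \in P -> k i (mn i) <= k i x.
  by rewrite /mn; case: arg_minnP => // y _ H; exact: H.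
have mnE i x : x \in P -> (forall y, y \in P -> k i x <= k i y) -> x = mn i.
  move=> xP H; apply: (@k_inj i); apply/eqP; rewrite eqn_leq mn_le// andbT.
  exact: H.
have CE i : (i \in C) = (inr i \notin B) by rewrite inE.
have PE x : (x \in P) = (inl x \in B) by rewrite inE.
have mn_sur : mn @: C = P.
  apply/eqP; rewrite eqEsubset; apply/andP; split.
    by apply/subsetP => _ /imsetP[i _ ->].
  apply/subsetP => x xP; have /dominantP/(_ x)[i iC H] := domB.
  by apply/imsetP; exists i; rewrite ?CE//; apply: mnE => // y; rewrite PE; exact: H.
have two_out a b : a \in C -> b \in C -> a != b ->
    ~ P \subset mn @: (C :\ a :\ b).
  move=> aC bC ab /subset_leq_card/leq_trans/(_ (leq_imset_card _ _)).
  have := cardsD1 a C; have := cardsD1 b (C :\ a).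
  by rewrite !in_setD1 aC bC eq_sym ab /= cardC; lia.
have [i [j [iC jC ij mnij]]] :
    exists i j, [/\ i \in C, j \in C, i != j & mn i = mn j].
  have /dinjectivePn[i iC [j]] : ~~ dinjectiveb mn C.
    by apply/negP => /dinjectiveP/card_in_imset; rewrite mn_sur cardC; lia.
  by rewrite inE => /andP[/= ji jC] mnij; exists i, j; rewrite eq_sym.
have mn_surD1 a b : a != b -> mn a = mn b -> b \in C -> mn @: (C :\ a) = P.
  move=> ab mnab bC; apply/eqP; rewrite eqEsubset -{1}mn_sur imsetS ?subD1set//=.
  rewrite -mn_sur; apply/subsetP => _ /imsetP[l lC ->].
  have [->|la] := eqVneq l a; last by apply/imset_f; rewrite in_setD1 la.
  by rewrite mnab; apply/imset_f; rewrite in_setD1 eq_sym ab.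
have suri := mn_surD1 _ _ ij mnij jC.
have surj : mn @: (C :\ j) = P by apply: (mn_surD1 _ i); rewrite // eq_sym.
have sur_pair l : l \in C -> P \subset mn @: (C :\ l) -> l = i \/ l = j.
  move=> lC sur; suff /orP[/eqP|/eqP] : (l == i) || (l == j) by [left|right].
  rewrite -[_ || _]negbK negb_or; apply/negP => /andP[li lj].
  apply: (two_out _ _ lC jC lj).
  apply: (subset_trans sur); apply/subsetP => _ /imsetP[a /setD1P[al aC] ->].
  have [->|aj] := eqVneq a j; last by apply/imset_f; rewrite !in_setD1 aj al aC.
  by rewrite -mnij; apply/imset_f; rewrite !in_setD1 ij eq_sym li iC.
pose M l := [set y | [forall l' in C :\ l, k l' (mn l') < k l' y]].
have MP l y : reflect (forall l', l' \in C -> l' != l -> k l' (mn l') < k l' y)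
                      (y \in M l).
  rewrite inE; apply: (iffP forall_inP) => H l'.
    by move=> l'C l'l; apply: H; rewrite in_setD1 l'l.
  by move=> /setD1P[l'l l'C]; exact: H.
(* [zz l] is the element that completes [B] to a room on the side of [l]. *)
pose zz l := if [pick y in M l] is Some y then inl [arg max_(x > y in M l) k l x]
  else inr l : T + I.
have zzP l : (exists x, [/\ zz l = inl x, x \in M l &
        forall y, y \in M l -> k l y <= k l x])
     \/ (zz l = inr l /\ M l = set0).
  rewrite /zz; case: pickP => [y yM|M0]; [left|right].
    by case: arg_maxnP => // x xM xmax; exists x.
  by split=> //; apply/setP => y; rewrite M0 inE.
have zz_compl l : l \in C -> mn @: (C :\ l) = P -> zz l \in room_completions B.
  move=> lC sur; rewrite inE; case: (zzP l) => [[x [-> xM xmax]]|[-> M0]].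
    have xP : x \notin P.
      rewrite -sur; apply/imsetP => -[l' /setD1P[l'l l'C] xE].
      by have /MP/(_ l' l'C l'l) := xM; rewrite -xE ltnn.
    rewrite -PE xP /=; apply/dominantP => y.
    have [yM|yM] := boolP (y \in M l).
      exists l; first by rewrite !inE -CE.
      move=> w; rewrite !inE => /orP[/eqP[->]|wB]; first exact: xmax.
      have /dominantP/(_ y)[l' l'C H] := domB.
      have [<-|l'l] := eqVneq l' l; first exact: H.
      have /MP/(_ l') := yM; rewrite CE => /(_ l'C l'l).
      by rewrite ltnNge H// -PE.
    have /forall_inPn[l' /setD1P[l'l l'C] H] :
      ~~ [forall l' in C :\ l, k l' (mn l') < k l' y] by move: yM; rewrite inE.
    exists l'; first by rewrite !inE -CE.
    move=> w; rewrite !inE => /orP[/eqP[->]|wB].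
      have /MP/(_ l' l'C l'l)/ltnW := xM; apply: leq_trans.
      by rewrite leqNgt.
    by apply: leq_trans (mn_le l' w _); rewrite ?PE// leqNgt.
  rewrite -CE lC /=; apply/dominantP => y.
  have : y \notin M l by rewrite M0 inE.
  rewrite inE => /forall_inPn[l' /setD1P[l'l l'C] H].
  exists l'.
    by rewrite !inE negb_or -CE l'C andbT; apply: contra l'l => /eqP[->].
  move=> w; rewrite !inE /= => wB.
  by apply: leq_trans (mn_le l' w _); rewrite ?PE// leqNgt.
(* In a room all minimizers are distinct, so the added element can only resolve
   the collision of [i] and [j]. *)
have compl_zz z : z \in room_completions B -> z = zz i \/ z = zz j.
  rewrite inE => /andP[]; case: z => [x|l] zB /dominantP dom.
    have [k0 k0C k0min] := dom x.
    have {}k0C : k0 \in C by rewrite CE; apply: contra k0C; rewrite !inE.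
    have sub w : w \in P -> exists l, [/\ l \in C, k l w <= k l x & w = mn l].
      move=> wP; have [l lC lmin] := dom w; exists l; split.
      - by rewrite CE; apply: contra lC; rewrite !inE.
      - by apply: lmin; rewrite !inE eqxx.
      - by apply: mnE => // y yP; apply: lmin; rewrite !inE -PE yP orbT.
    have notx w : w \in P -> w != x by apply: contraTneq => ->; rewrite PE.
    have xM : x \in M k0.
      apply/MP => l lC lk0; rewrite ltnNge; apply/negP => lx.
      apply: (two_out k0 l) => //; first by rewrite eq_sym.
      apply/subsetP => w wP; have [a [aC wx wE]] := sub w wP.
      rewrite wE; apply/imset_f; rewrite !in_setD1 aC andbT.
      apply/andP; split; apply: contraTneq wx => ->; rewrite -ltnNge.
        rewrite ltn_neqAle (leq_trans lx (mn_le _ _ wP)) andbT.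
        by apply: contra (notx w wP) => /eqP/k_inj->.
      rewrite ltn_neqAle k0min ?inE -?PE ?wP ?orbT// andbT.
      by apply: contra (notx w wP) => /eqP/k_inj->.
    have xzz : inl x = zz k0.
      case: (zzP k0) => [[x' [-> x'M x'max]]|[_ M0]]; last by rewrite M0 inE in xM.
      congr inl; apply: (@k_inj k0); apply/eqP; rewrite eqn_leq x'max//=.
      have [l lC lmin] := dom x'.
      have {}lC : l \in C by rewrite CE; apply: contra lC; rewrite !inE.
      have [<-|lk0] := eqVneq l k0; first by apply: lmin; rewrite !inE eqxx.
      have /MP/(_ l lC lk0) := x'M; rewrite ltnNge lmin// !inE -PE mnP orbT//.
    rewrite xzz; suff [->|->] : k0 = i \/ k0 = j by [left|right].
    apply: sur_pair => //; apply/subsetP => w wP.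
    have [a [aC wx wE]] := sub w wP; rewrite wE; apply/imset_f.
    rewrite in_setD1 aC andbT; apply: contraTneq wx => ->; rewrite -ltnNge.
    rewrite ltn_neqAle k0min ?inE -?PE ?wP ?orbT// andbT.
    by apply: contra (notx w wP) => /eqP/k_inj->.
  have lC : l \in C by rewrite CE.
  have domE y : exists2 a, a \in C :\ l & forall w, w \in P -> k a y <= k a w.
    have [a aC amin] := dom y; exists a.
      move: aC; rewrite !inE negb_or => /andP[al ->]; rewrite andbT.
      by apply: contra al => /eqP->.
    by move=> w wP; apply: amin; rewrite !inE -PE wP orbT.
  have -> : inr l = zz l.
    case: (zzP l) => [[x' [_ x'M _]]|[-> //]].
    have [a /setD1P[al aC] amin] := domE x'.
    by have /MP/(_ a aC al) := x'M; rewrite ltnNge amin.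
  suff [->|->] : l = i \/ l = j by [left|right].
  apply: sur_pair => //; apply/subsetP => w wP.
  have [a aC amin] := domE w; rewrite (mnE a w wP amin); exact: imset_f.
have zzij : zz i != zz j.
  apply/eqP; case: (zzP i) => [[x [-> xMi _]]|[-> _]];
    case: (zzP j) => [[y [-> yMj _]]|[-> _]] // [].
    move=> xy; subst y; have /dominantP/(_ x)[l] := domB.
    rewrite -CE => lC lmin; have := lmin (mn l); rewrite -PE mnP => /(_ isT).
    rewrite leqNgt => /negP; apply.
    have [li|li] := eqVneq l i; last by move/MP: xMi; apply.
    by move/MP: yMj; apply => //; rewrite li.
  by move/eqP; rewrite (negPf ij).
have -> : room_completions B = [set zz i; zz j].
  apply/setP => z; rewrite in_set2; apply/idP/orP => [/compl_zz[->|->]|].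
  - by left.
  - by right.
  by case=> /eqP->; apply: zz_compl.
by rewrite cards2 zzij.
Qed.

(** A door without points has a single active index [i0]; it lies in exactly one
    room, obtained by adding the [k i0]-largest point. *)
Lemma card_room_completions_point_free i0 (x0 : T) :
  #|room_completions [set inr l | l in [set~ i0]]| = 1.
Proof.
have [x _ max_x] := @arg_maxnP _ x0 predT (k i0) isT.
have xmax y : k i0 y <= k i0 x by exact: max_x.
have notinB z : (z \in ([set inr l | l in [set~ i0]] : {set T + I})) = 
    if z is inr l then l != i0 else false.
  apply/imsetP/idP => [[l + ->]|]; first by rewrite !inE.
  by case: z => // l li0; exists l; rewrite ?inE.
suff -> : room_completions [set inr l | l in [set~ i0]] = [set inl x].
  by rewrite cards1.
apply/setP => z; rewrite !inE notinB; apply/andP/eqP => [[]|->].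
  case: z => [y|l]; last first.
    rewrite negbK => /eqP-> /dominantP/(_ x0)[l']; rewrite !inE notinB.
    by rewrite negb_or negbK => /andP[+ /eqP lE]; rewrite lE eqxx.
  move=> _ /dominantP/(_ x)[l]; rewrite !inE notinB negbK => /eqP-> H.
  congr inl; apply: (@k_inj i0); apply/eqP; rewrite eqn_leq xmax//=.
  by apply: H; rewrite !inE eqxx.
split=> //; apply/dominantP => y; exists i0; first by rewrite !inE notinB eqxx.
by move=> w; rewrite !inE notinB orbF => /eqP[->]; exact: xmax.
Qed.

Context (c : T -> I).

(** A colouring of the points, extended by giving each index its own colour. *)
Definition color z := match z with inl x => c x | inr i => i end.

(** The elements of [A] whose removal leaves exactly the colours other than [i0]. *)
Definition door_vertices (i0 : I) A :=
  [set z in A | color @: (A :\ z) == [set~ i0]].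

(** A set using all colours has exactly one such element; any other set has none or
    two, the two elements of the same colour. *)
Lemma odd_door_vertices i0 A :
  #|A| = #|I| -> odd #|door_vertices i0 A| = (color @: A == [set: I]).
Proof.
move=> cardA; have [cA|cA] := eqVneq (color @: A) setT.
  have cinj : {in A &, injective color}.
    by apply/imset_injP; rewrite cA cardsT cardA.
  have : i0 \in color @: A by rewrite cA.
  case/imsetP => z0 z0A i0E; suff -> : door_vertices i0 A = [set z0] by rewrite cards1.
  apply/setP => z; rewrite in_set1 inE; apply/andP/eqP => [[zA /eqP cz]|->].
    apply/eqP; apply: contraT => zz0; have /setP/(_ i0) := cz.
    rewrite in_setC1 eqxx i0E imset_f// in_setD1 z0A eq_sym.
    by rewrite zz0.
  split=> //; apply/eqP/setP => i; rewrite in_setC1; apply/imsetP/idP.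
    move=> [w /setD1P[wz0 wA] ->]; apply: contra wz0 => /eqP.
    by rewrite i0E => /cinj ->.
  move=> ii0; have /imsetP[w wA iE] : i \in color @: A by rewrite cA.
  exists w => //; rewrite in_setD1 wA andbT; apply: contra ii0 => /eqP wE.
  by rewrite iE wE i0E.
apply/negbTE.
have [->|/set0Pn[z]] := eqVneq (door_vertices i0 A) set0; first by rewrite cards0.
rewrite inE => /andP[zA /eqP cz].
have cinj : {in A :\ z &, injective color}.
  have e1 : #|A| = #|A :\ z|.+1 by rewrite (cardsD1 z A) zA.
  have e2 : #|[set~ i0]|.+1 = #|I| by rewrite -(cardsC [set i0]) cards1.
  by apply/imset_injP; rewrite cz; apply/eqP; move: cardA; rewrite e1 -e2 => -[].
have cz0 : color z != i0.
  apply: contra cA => /eqP cz0; rewrite -(setD1K zA) imsetU1 cz cz0.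
  by apply/eqP/setP => i; rewrite !inE orbN.
have : color z \in color @: (A :\ z) by rewrite cz in_setC1.
case/imsetP => z' z'Az czz'; have /setD1P[z'z z'A] := z'Az.
suff -> : door_vertices i0 A = [set z; z'] by rewrite cards2 eq_sym z'z.
have swap : color @: (A :\ z') = [set~ i0].
  rewrite -cz; apply/setP => i; apply/imsetP/imsetP => -[w /setD1P[wz wA] ->].
    have [wz'|wz'] := eqVneq w z; last by exists w; rewrite // in_setD1 wz'.
    by exists z' => //; rewrite wz'.
  have [wz'|wz'] := eqVneq w z'; last by exists w; rewrite // in_setD1 wz'.
  by exists z; rewrite ?wz'// in_setD1 eq_sym z'z.
apply/setP => w; rewrite in_set2 inE; apply/andP/orP; last first.
  by case=> /eqP->; rewrite ?zA ?z'A ?cz ?swap eqxx.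
move=> [wA /eqP cw]; have [->|wz] := eqVneq w z; [by left|right].
apply: contraT => wz'.
have : color w \in color @: (A :\ w).
  by rewrite cw -cz; apply: imset_f; rewrite in_setD1 wz.
case/imsetP => v /setD1P[vw vA] cwv.
have [vz|vz] := eqVneq v z.
  have := cinj w z'; rewrite !in_setD1 wz wA z'z z'A => /(_ isT isT).
  by rewrite cwv vz czz' => /(_ erefl) wE; rewrite wE eqxx in wz'.
have := cinj w v; rewrite !in_setD1 wz wA vz vA => /(_ isT isT cwv) wE.
by rewrite wE eqxx in vw.
Qed.

(** Double counting of the pairs made of a room and a door that it contains. *)
Lemma sum_door_vertices i0 :
  \sum_(A : {set T + I} | (#|A| == #|I|) && dominant A) #|door_vertices i0 A| =
  \sum_(B : {set T + I} | (#|B|.+1 == #|I|) && (color @: B == [set~ i0]))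
     #|room_completions B|.
Proof.
under eq_bigr do rewrite -sum1_card.
under [RHS]eq_bigr do rewrite -sum1_card.
rewrite (exchange_big_dep predT)//= [RHS](exchange_big_dep predT)//=.
apply: eq_bigr => z _.
rewrite (reindex_onto (fun B => z |: B) (fun A => A :\ z)) /=; last first.
  by move=> A /andP[_]; rewrite inE => /andP[zA _]; exact: setD1K.
apply: eq_bigl => B; have [zB|zB] := boolP (z \in B).
  rewrite [in RHS]inE zB /= andbF; apply/negbTE; rewrite negb_and orbC.
  by apply/orP; left; apply: contraTneq zB => <-; rewrite !inE eqxx.
rewrite inE setU11 /= setU1K// eqxx andbT [RHS]andbC inE zB cardsU1 zB add1n.
by case: dominant; rewrite ?andbT ?andbF.
Qed.

(** Scarf's lemma.  The incidences between rooms and doors coloured by everything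
    but [i0] are odd in number: every such door is in two rooms, except the one
    without points, which is in one.  Hence some room carries all the colours. *)
Lemma colorful_room (i0 : I) (x0 : T) :
  exists A, [/\ #|A| = #|I|, dominant A & color @: A = [set: I]].
Proof.
have even_sum (U : finType) (P : pred U) (F : U -> nat) :
    (forall u, P u -> ~~ odd (F u)) -> ~~ odd (\sum_(u | P u) F u).
  move=> H; apply: (big_ind (fun n => ~~ odd n)) => // m n.
  by rewrite oddD => /negPf-> /negPf->.
have [/existsP[A /and3P[/eqP cardA domA /eqP cA]]|] := boolP [exists A : {set T + I},
    [&& #|A| == #|I|, dominant A & color @: A == [set: I]]]; first by exists A.
move=> /existsPn none.
have : odd (\sum_(A : {set T + I} | (#|A| == #|I|) && dominant A) #|door_vertices i0 A|).
  rewrite sum_door_vertices.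
  rewrite (bigD1 [set inr l | l in [set~ i0]]) /=; last first.
    rewrite card_imset; last by move=> ? ? [].
    have := cardsC [set i0]; rewrite cards1 add1n => ->; rewrite eqxx /=.
    by rewrite -imset_comp /= imset_id.
  rewrite card_room_completions_point_free// oddD /=; apply: even_sum => B.
  case/andP => /andP[/eqP cardB /eqP cB] BB0.
  have [domB|ndomB] := boolP (dominant B); last first.
    suff -> : room_completions B = set0 by rewrite cards0.
    apply/setP => z; rewrite !inE; apply/negP => /andP[_].
    by move/(dominantS (subsetUr _ _)); exact/negP.
  rewrite card_room_completions_door//; apply: contra BB0 => /eqP PB.
  have Binr z : z \in B -> exists2 l, z = inr l & l != i0.
    case: z => [x xB|l lB].
      by have /setP/(_ x) := PB; rewrite !inE xB.
    by exists l => //; rewrite -in_setC1 -cB; apply/imsetP; exists (inr l).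
  rewrite eqEsubset; apply/andP; split; apply/subsetP => z.
    by move=> /Binr[l -> li0]; rewrite imset_f// in_setC1.
  case/imsetP => l; rewrite -cB => /imsetP[w wB ->] ->.
  by have [l' wE _] := Binr w wB; rewrite wE /= -wE.
move=> odds; exfalso; move: odds; apply/negP/even_sum => A /andP[/eqP cardA domA].
by rewrite odd_door_vertices//; have := none A; rewrite cardA eqxx domA.
Qed.
End Scarf.

(** * A dual Sperner lemma on the integral simplex *)

(** Scarf's lemma for the points [l] of the integral simplex of sum [M], index [i]
    ordering them by their coordinate [l i].  The points of a colourful room have
    all their coordinates above a common lower bound [m], whose sum is almost [M]
    by dominance; a colour [i] missing on these points is an inactive index, for
    which [m i] can be taken to be zero. *)
Lemma sperner_grid (N M : nat) (c : {ffun 'I_N -> 'I_M.+1} -> 'I_N) :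
  0 < N <= M ->
  exists (L : {set {ffun 'I_N -> 'I_M.+1}}) (m : 'I_N -> nat),
    [/\ L != set0,
        forall l, l \in L -> \sum_i l i = M /\ forall i, m i <= l i,
        M < \sum_i m i + N &
        forall i, m i = 0 \/ exists2 l, l \in L & c l = i].
Proof.
case: N c => // N c /= NM.
pose P (l : {ffun 'I_N.+1 -> 'I_M.+1}) := \sum_i l i == M.
pose T : finType := {l | P l}.
(* The [i]-th coordinate, with ties broken by the enumeration of [T]. *)
pose k i (x : T) := val x i * #|T| + enum_rank x.
have kle i x y : k i x <= k i y -> val x i <= val y i.
  have aux K a b r s : s < K -> a * K + r <= b * K + s -> a <= b by nia.
  exact/aux/ltn_ord.
have kinj i : injective (k i).
  move=> x y kxy; have vxy : val x i = val y i.
    by apply/val_inj/eqP; rewrite eqn_leq !kle ?kxy.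
  apply/enum_rank_inj/val_inj; move/eqP: kxy.
  by rewrite /k vxy eqn_add2l => /eqP.
have mk (f : 'I_N.+1 -> nat) : \sum_i f i = M ->
    exists x : T, forall i, val x i = f i :> nat.
  move=> fM; have fle i : f i < M.+1.
    by rewrite ltnS -fM (bigD1 i)//= leq_addr.
  have gP : P [ffun i => Ordinal (fle i)].
    by apply/eqP; rewrite -[RHS]fM; apply: eq_bigr => i _; rewrite ffunE.
  by exists (exist (fun l => P l) _ gP) => i /=; rewrite ffunE.
have [x0 _] : exists x : T, forall i, val x i = (if i == ord0 then M else 0) :> nat.
  by apply: mk; rewrite -big_mkcond/= big_pred1_eq.
have [A [cardA domA cA]] := @colorful_room T _ k kinj (c \o val) ord0 x0.
have [x xA] : exists x, x \in points A.
  apply/set0Pn; rewrite -card_gt0.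
  have -> : #|points A| = #|active A|.
    by have := card_points_active A; rewrite cardA; lia.
  rewrite card_gt0; have /dominantP/(_ x0)[i iA _] := domA.
  by apply/set0Pn; exists i; rewrite inE.
pose mn i := [arg min_(y < x in points A) k i y].
pose m i := if inr i \in A then 0 else val (mn i) i : nat.
have mnA i : mn i \in points A by rewrite /mn; case: arg_minnP.
have mnle i y : y \in points A -> k i (mn i) <= k i y.
  by rewrite /mn; case: arg_minnP => // z _ H; exact: H.
exists [set val y | y in points A], m; split.
- by apply/set0Pn; exists (val x); exact: imset_f.
- move=> _ /imsetP[y yA ->]; split=> [|i]; first exact/eqP/(valP y).
  by rewrite /m; case: ifP => // _; exact/kle/mnle.
- rewrite ltnNge; apply/negP => small.
  (* Otherwise raising every lower bound by one leaves room for a point above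
     all of them, against dominance. *)
  pose f i := (m i).+1 + (if i == ord0 then M - (\sum_i m i + N.+1) else 0).
  have [y yE] : exists y : T, forall i, val y i = f i :> nat.
    apply: mk; rewrite /f big_split/= -[X in _ + X]big_mkcond/= big_pred1_eq.
    under eq_bigr do rewrite -addn1.
    by rewrite big_split/= sum1_card card_ord; lia.
  have /dominantP/(_ y)[i iA ymin] := domA.
  have : k i y <= k i (mn i) by apply: ymin; have := mnA i; rewrite inE.
  by move/kle; rewrite yE /f /m (negPf iA); lia.
- move=> i; rewrite /m; have [|iA] := boolP (inr i \in A); [by left|right].
  have : i \in color (c \o val) @: A by rewrite cA.
  case/imsetP => -[y yA /= ->|l lA /= il]; last by rewrite il lA in iA.
  by exists (val y) => //; apply: imset_f; rewrite inE.
Qed.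

(* The set-theoretic notations of classical analysis would hide those of finite
   sets in the combinatorial part above. *)
From mathcomp Require Import all_classical all_reals all_analysis.
Import numFieldNormedType.Exports.
Local Open Scope classical_set_scope.
Local Open Scope ring_scope.

(** * Diffuse functions on atomless probability spaces *)

Lemma exp2V_small (R : realType) (a e : R) : 0 < e ->
  exists n, a * 2 ^- n <= e.
Proof.
move=> e0; exists (Num.truncn (a / e)).+1.
rewrite ler_pdivrMr ?exprn_gt0// mulrC -ler_pdivrMr//.
have /ltW h : a / e < (Num.truncn (a / e)).+1%:R by exact: truncnS_gt.
by apply: (le_trans h); rewrite -natrX ler_nat; exact/ltnW/ltn_expl.
Qed.

Section Diffuse.
Context (R : realType) (d : measure_display) (S : measurableType d).
Context (mu : probability S R).
Implicit Types A B C D : set S.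

(** The measure of [A] as a real number. *)
Definition mass A : R := fine (mu A).

Lemma mass_ge0 A : 0 <= mass A. Proof. exact: fine_ge0. Qed.

Lemma mass0 : mass set0 = 0. Proof. by rewrite /mass measure0. Qed.

Lemma massE A : measurable A -> mu A = (mass A)%:E.
Proof. by move=> mA; rewrite /mass fineK// fin_num_measure. Qed.

Lemma le_mass A B : measurable A -> measurable B -> A `<=` B -> mass A <= mass B.
Proof.
by move=> mA mB AB; rewrite -lee_fin -!massE// le_measure// inE.
Qed.

Lemma massU A B : measurable A -> measurable B -> A `&` B = set0 ->
  mass (A `|` B) = mass A + mass B.
Proof.
move=> mA mB AB; apply: EFin_inj; rewrite EFinD -!massE//; last exact: measurableU.
by rewrite measureU.
Qed.

Lemma massD A B : measurable A -> measurable B -> B `<=` A ->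
  mass (A `\` B) = mass A - mass B.
Proof.
move=> mA mB BA; have := massU mB (measurableD mA mB).
rewrite setDIK => /(_ erefl); rewrite setDUK// => ->.
by rewrite addrC addKr.
Qed.

Hypothesis atom : atomless mu.

Lemma small_subset A (e : R) : measurable A -> 0 < mass A -> 0 < e ->
  exists C, [/\ measurable C, C `<=` A, 0 < mass C & mass C <= e].
Proof.
move=> mA A0 e0.
have half D : measurable D -> 0 < mass D ->
    exists C, [/\ measurable C, C `<=` D, 0 < mass C & mass C <= mass D / 2].
  move=> mD D0; have [|C [mC CD]] := atom mD.
    by rewrite massE.
  rewrite !massE// !lte_fin => C0 CltD.
  have [CD2|CD2] := leP (mass C) (mass D / 2); first by exists C.
  exists (D `\` C); rewrite massD//; split; [exact: measurableD| by move=> ? []|lra|lra].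
have {}half n : exists C,
    [/\ measurable C, C `<=` A, 0 < mass C & mass C <= mass A / 2 ^+ n].
  elim: n => [|n [C [mC CA C0 CAn]]]; first by exists A; split; rewrite ?expr0 ?divr1.
  have [C' [mC' C'C C'0 C'h]] := half C mC C0.
  exists C'; split => //; first exact: subset_trans C'C CA.
  rewrite exprSr invfM mulrA; apply: (le_trans C'h); lra.
have [n ne] := exp2V_small (mass A) e0.
have [C [? ? ? Cn]] := half n; exists C; split=> //; exact: le_trans ne.
Qed.

(** Sierpinski's theorem.  Starting from the empty set, keep adding a piece whose
    mass is at least half the supremum of the masses that still fit below [r].  If
    the union stayed below [r], a small piece of the rest would fit at each step,
    so that the masses of the added pieces would be bounded away from zero. *)
Lemma atomless_subset D (r : R) : measurable D -> 0 <= r <= mass D ->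
  exists B, [/\ measurable B, B `<=` D & mass B = r].
Proof.
move=> mD /andP[r0 rD].
pose adm B C := [/\ measurable C, C `<=` D `\` B & mass B + mass C <= r].
pose ok B := [/\ measurable B, B `<=` D & mass B <= r].
have greedy B : ok B -> exists C, adm B C /\ forall C', adm B C' -> mass C' <= 2 * mass C.
  move=> [mB BD Br]; pose V := [set mass C | C in adm B].
  have V0 : V 0.
    exists set0; last by rewrite mass0.
    by split=> //; rewrite mass0 addr0.
  have Vub : ubound V r.
    by move=> _ [C [_ _ BC] <-]; have := mass_ge0 B; lra.
  have supV : has_sup V by split; [exists 0|exists r].
  have [s0|s0] := leP (sup V) 0.
    exists set0; split.
      by split=> //; rewrite mass0 addr0.
    move=> C' C'adm; rewrite mass0 mulr0.
    by apply: le_trans s0; apply: ub_le_sup; [exists r|exists C'].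
  have [_ [C Cadm <-] Cs] := sup_adherent (divr_gt0 s0 (ltr0n R 2)) supV.
  exists C; split=> // C' C'adm.
  have : mass C' <= sup V by apply: ub_le_sup; [exists r|exists C'].
  lra.
have /choice[g gP] : forall B, exists C,
    ok B -> adm B C /\ forall C', adm B C' -> mass C' <= 2 * mass C.
  move=> B; have [okB|nB] := pselect (ok B); last by exists set0.
  by have [C CP] := greedy B okB; exists C.
pose Bn n := iter n (fun B => B `|` g B) set0.
have okB n : ok (Bn n).
  elim: n => [|n okn]; first by split;
    [exact: measurable0|exact: sub0set|rewrite [Bn 0%N]/= mass0].
  have [[mC CD BC] _] := gP _ okn; have [mB BD _] := okn; split.
  - exact: measurableU.
  - by move=> s [/BD//|/CD[]].
  - rewrite /= massU//; apply/seteqP; split=> // s [sB /CD[]]//.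
have BS n : Bn n `<=` Bn n.+1 by move=> s sB; left.
pose B := \bigcup_n Bn n.
have mB : measurable B by apply: bigcup_measurable => n _; have [] := okB n.
have BD : B `<=` D by move=> s [n _]; have [_ + _] := okB n; exact.
have Bcvg : mass \o Bn @ \oo --> mass B.
  apply: fine_cvg; rewrite -massE//.
  apply: (@nondecreasing_cvg_mu _ _ _ mu Bn) => //.
    by move=> n; have [] := okB n.
  by apply/nondecreasing_seqP => n; apply/subsetPset/BS.
have Br : mass B <= r.
  rewrite -(cvg_lim (@Rhausdorff R) Bcvg); apply: limr_le.
    by apply/cvg_ex; exists (mass B).
  by apply: nearW => n; have [] := okB n.
exists B; split=> //; apply/eqP; rewrite eq_le Br leNgt; apply/negP => ltr.
have DB0 : 0 < mass (D `\` B) by rewrite massD//; lra.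
have rB0 : 0 < r - mass B by rewrite subr_gt0.
have [C [mC CDB C0 Cr]] := small_subset (measurableD mD mB) DB0 rB0.
have Cg n : mass C <= 2 * mass (g (Bn n)).
  have [_] := gP _ (okB n); apply; split=> //.
    by move=> s /CDB[sD sB]; split=> // sBn; apply: sB; exists n.
  have : mass (Bn n) <= mass B.
    by apply: le_mass => //; [have [] := okB n|move=> s sB; exists n].
  lra.
have Bge n : n%:R * mass C <= 2 * mass (Bn n).
  elim: n => [|n IH]; first by rewrite mul0r mulr_ge0// mass_ge0.
  have [[mg gD _] _] := gP _ (okB n).
  rewrite /= massU//; last by apply/seteqP; split=> // s [sB /gD[]].
    by have := Cg n; rewrite -natr1; lra.
  by have [] := okB n.
have /ltW := truncnS_gt (2 * r / mass C); rewrite leNgt => /negP; apply.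
rewrite ltr_pdivlMr//.
have := Bge (Num.truncn (2 * r / mass C)).+2; have [_ _] := okB (Num.truncn (2 * r / mass C)).+2.
rewrite -[in X in _ -> X -> _]natr1; lra.
Qed.

Lemma atomless_mid A C : measurable A -> measurable C -> A `<=` C ->
  exists B, [/\ measurable B, A `<=` B, B `<=` C & mass B = (mass A + mass C) / 2].
Proof.
move=> mA mC AC; have le := le_mass mA mC AC.
have [|D [mD DCA Dr]] := @atomless_subset (C `\` A) ((mass C - mass A) / 2)
  (measurableD mC mA).
  by rewrite massD//; lra.
exists (A `|` D); split.
- exact: measurableU.
- exact: subsetUl.
- by move=> s [/AC//|/DCA[]].
- rewrite massU// ?Dr; first by lra.
  by apply/seteqP; split=> // s [sA /DCA[]].
Qed.

(** Each [F n.+1] refines [F n] by inserting a set halfway between consecutive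
    members. *)
Lemma dyadic_family : exists F : nat -> nat -> set S,
  [/\ forall n j, measurable (F n j),
      forall n j i, (j <= i)%N -> F n j `<=` F n i,
      forall n p j, F (p + n)%N (j * 2 ^ p)%N = F n j,
      F 0%N 0%N = set0 /\ F 0%N 1%N = setT &
      forall n j, mass (F n j.+1) - mass (F n j) <= 2 ^- n].
Proof.
have /choice[mid midP] : forall AC : set S * set S, exists B,
    measurable AC.1 -> measurable AC.2 -> AC.1 `<=` AC.2 ->
    [/\ measurable B, AC.1 `<=` B, B `<=` AC.2 &
        mass B = (mass AC.1 + mass AC.2) / 2].
  move=> [A C] /=.
  have [[mA [mC AC]]|nAC] := pselect (measurable A /\ measurable C /\ A `<=` C).
    by have [B BP] := atomless_mid mA mC AC; exists B.
  by exists set0 => mA mC AC; exfalso; apply: nAC.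
pose F := fix F n j := if n is n'.+1 then
    if odd j then mid (F n' j./2, F n' j./2.+1) else F n' j./2
  else if j == 0%N then set0 else setT : set S.
have FP n : (forall j, measurable (F n j)) /\
    (forall j, F n j `<=` F n j.+1).
  elim: n => [|n [mF Fsub]]; first by split=> -[|j] //=.
  have midF j : [/\ measurable (mid (F n j, F n j.+1)),
      F n j `<=` mid (F n j, F n j.+1), mid (F n j, F n j.+1) `<=` F n j.+1 &
      mass (mid (F n j, F n j.+1)) = (mass (F n j) + mass (F n j.+1)) / 2].
    exact: (midP (_, _) (mF _) (mF _) (Fsub _)).
  split=> j /=; first by case: ifP => // _; have [] := midF j./2.
  rewrite uphalf_half; case: (odd j) => /=; have [_ ? ? _] := midF j./2 => //.
have Fdouble n p j : F (p + n)%N (j * 2 ^ p)%N = F n j.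
  elim: p => [|p IH]; first by rewrite expn0 muln1.
  by rewrite addSn/= expnS mulnCA mul2n odd_double doubleK.
exists F; split=> //.
- by move=> n j; have [] := FP n.
- move=> n j i /subnK <-; elim: (i - j)%N => // k; move/subset_trans; apply.
  by have [_] := FP n; apply.
- elim=> [|n IH] j.
    rewrite expr0 invr1; have [mF _] := FP 0%N.
    have : mass (F 0%N j.+1) <= 1.
      by rewrite /mass -fine1 fine_le ?fin_num_measure//; exact: probability_le1.
    by have := mass_ge0 (F 0%N j); lra.
  have [mF Fsub] := FP n; have := IH j./2.
  have [_ _ _ /=] := midP (F n j./2, F n j./2.+1) (mF _) (mF _) (Fsub _).
  rewrite exprS invfM uphalf_half; case: (odd j) => /= ->; lra.
Qed.

(** [U s] is the infimum of the dyadic numbers [j / 2 ^ n] such that [s] belongs to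
    [F n j]. *)
Lemma diffuse_function : exists U : S -> R,
  [/\ forall s, 0 <= U s <= 1,
      forall t, measurable [set s | U s < t] &
      forall t, mu.-negligible [set s | U s = t]].
Proof.
have [F [mF Fle Fdouble [F00 F01] Fmass]] := dyadic_family.
pose V s := [set x : R | exists n j, F n j s /\ x = j%:R / 2 ^+ n].
have V1 s : V s 1 by exists 0%N, 1%N; rewrite F01 expr0 divr1.
have lbV s : lbound (V s) 0 by move=> _ [n [j [_ ->]]]; rewrite divr_ge0.
have F0 n : F n 0%N = set0 by rewrite -F00 -(Fdouble 0%N n) mul0n addn0.
pose U s := inf (V s).
have UltP s t : U s < t <-> exists n j, F n j s /\ j%:R / 2 ^+ n < t.
  split=> [/inf_lt|[n [j [Fs jt]]]].
    by case; [exists 1|move=> _ [n [j [Fs ->]]] lt; exists n, j].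
  by apply: le_lt_trans jt; apply: ge_inf; [exists 0|exists n, j].
have Fcross n j n' j' : (j'%:R / 2 ^+ n' <= j%:R / 2 ^+ n :> R) -> F n' j' `<=` F n j.
  rewrite ler_pdivrMr ?exprn_gt0// mulrAC ler_pdivlMr ?exprn_gt0//.
  rewrite -!natrX -!natrM ler_nat => le.
  by rewrite -(Fdouble n' n) -(Fdouble n n') addnC; exact: Fle.
exists U; split.
- move=> s; apply/andP; split; last by apply: ge_inf; [exists 0|].
  by apply: lb_le_inf; [exists 1|].
- move=> t; have -> : [set s | U s < t] =
     \bigcup_n \bigcup_(j in [set j | j%:R / 2 ^+ n < t]) F n j.
    apply/seteqP; split=> s /=.
      by move/UltP => [n [j [Fs lt]]]; exists n => //; exists j.
    by move=> [n _ [j lt Fs]]; apply/UltP; exists n, j.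
  by apply: bigcup_measurable => n _; apply: bigcup_measurable.
- move=> t; have [t0|t0] := leP 0 t; last first.
    suff -> : [set s | U s = t] = set0 by exact: negligible_set0.
    rewrite -subset0 => s /= Ust; suff : 0 <= U s by rewrite Ust leNgt t0.
    by apply: lb_le_inf; [exists 1|].
  pose j n := Num.truncn (t * 2 ^+ n).
  pose G n := F n (j n).+1 `\` F n (j n).-1.
  have mG n : measurable (G n) by exact: measurableD.
  have Gmass n : mass (G n) <= 2 * 2 ^- n.
    rewrite /G massD//; last by apply: Fle; lia.
    have := Fmass n (j n).-1; have := Fmass n (j n); rewrite /G.
    by case: (j n) => [|k] /=; have : 0 <= 2 ^- n :> R by []; lra.
  exists (\bigcap_n G n); split.
  + exact: bigcap_measurable.
  + have mGG : measurable (\bigcap_n G n) by exact: bigcap_measurable.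
    rewrite massE//; congr EFin; apply/eqP; rewrite eq_le mass_ge0 andbT.
    apply/ler_addgt0Pl => e e0; rewrite addr0.
    have [n ne] := exp2V_small 2 e0.
    apply: le_trans ne; apply: le_trans (Gmass n); apply: le_mass => //.
    exact: bigcap_inf.
  + move=> s /= Ust n _; have tn : t * 2 ^+ n < (j n).+1%:R by exact: truncnS_gt.
    have tn' : (j n)%:R <= t * 2 ^+ n by rewrite truncn_le// mulr_ge0.
    split.
      have : U s < (j n).+1%:R / 2 ^+ n by rewrite Ust ltr_pdivlMr ?exprn_gt0.
      by move/UltP => [n' [j' [Fs /ltW/Fcross]]]; apply.
    move=> Fs; have j0 : (0 < j n)%N.
      by rewrite lt0n; apply/eqP => j0; move: Fs; rewrite j0 F0.
    have : U s < t by apply/UltP; exists n, (j n).-1; split=> //;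
      rewrite ltr_pdivrMr ?exprn_gt0//; apply: lt_le_trans tn'; rewrite ltr_nat; lia.
    by rewrite Ust ltxx.
Qed.
End Diffuse.

(** * Compact metrizable sets as images of the Cantor space *)

Section MetricCopy.
Context (R : realType) (Z : topologicalType) (z0 : Z) (dist : Z -> Z -> R).
Hypothesis dist0 : forall x y, dist x y = 0 <-> x = y.
Hypothesis distC : forall x y, dist x y = dist y x.
Hypothesis distD : forall x y z, dist x z <= dist x y + dist y z.
Hypothesis nbhs_dist : forall (x : Z) (V : set Z),
  nbhs x V <-> exists2 e : R, 0 < e & [set y | dist x y < e] `<=` V.

(** The space [Z] seen as a metric space through [dist]. *)
Definition metric_copy : Type := Z.

Let distxx (x : metric_copy) : dist x x = 0. Proof. exact/dist0. Qed.
Let dist_eq0 (x y : metric_copy) : dist x y = 0 -> x = y.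
Proof. by move/dist0. Qed.
Let dist_tri (y x z : metric_copy) : dist x z <= dist x y + dist y z.
Proof. exact: distD. Qed.

HB.instance Definition _ := Choice.on metric_copy.
HB.instance Definition _ :=
  isMetric.Build R metric_copy distxx dist_eq0 distC dist_tri.
HB.instance Definition _ := isPointed.Build metric_copy z0.

Lemma nbhs_metric_copy (x : metric_copy) : nbhs x = nbhs (x : Z).
Proof.
apply/seteqP; split=> V.
  by move=> /(@nbhs_ballP R metric_copy)[e /= e0 eV]; apply/nbhs_dist; exists e.
by move=> /nbhs_dist[e e0 eV]; apply/(@nbhs_ballP R metric_copy); exists e.
Qed.

Lemma cantor_surj_metrizable : compact [set: Z] ->
  exists f : cantor_space -> Z, continuous f /\ range f = setT.
Proof.
move=> cZ.
have cM : compact [set: metric_copy].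
  move=> F PF FT; have [p [_ pF]] := cZ F PF FT; exists p; split=> // A B FA.
  by rewrite nbhs_metric_copy; exact: pF.
have [f fc] := cantor_surj cM (@metric_hausdorff R metric_copy).
exists f; split.
  by move=> c V; rewrite -nbhs_metric_copy; exact: fc.
exact/surj_image_eq.
Qed.

End MetricCopy.

(** The Alexandroff-Hausdorff theorem for a compact metrizable subset. *)
Lemma cantor_parametrization (R : realType) (Y : topologicalType) (X : set Y) :
  X !=set0 -> compact X -> metrizable R (set_type X) ->
  exists q : cantor_space -> Y, continuous q /\ range q = X.
Proof.
move=> [x0 Xx0] cX [dist [dist0 distC distD nbhs_dist]].
have cZ : compact [set: set_type X].
  move=> F PF _; have FX : (set_val @ F) X.
    by apply: (@filterS _ F _ setT) filterT => x _; exact: set_valP.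
  have [p [Xp pF]] := cX _ _ FX.
  exists (exist _ p (mem_set Xp)); split=> // A B FA [_ [[W oW <-]] /= Wp WB].
  have [|_ [[a Aa <-] Wa]] := pF (set_val @` A) W _ (open_nbhs_nbhs (conj oW Wp)).
    by apply: (@filterS _ F _ A) FA => a Aa; exists a.
  by exists a; split=> //; exact: WB.
have [f [fc fX]] := cantor_surj_metrizable (exist _ x0 (mem_set Xx0) : set_type X)
  dist0 distC distD nbhs_dist cZ.
exists (set_val \o f); split.
  move=> c; apply: continuous_comp; first exact: fc.
  exact: initial_continuous.
apply/seteqP; split=> [_ [c _ <-]|x Xx]; first exact: set_valP.
have : range f (exist _ x (mem_set Xx)) by rewrite fX.
by move=> [c _ fE]; exists c => //=; rewrite fE.
Qed.

(** * Thresholds and dyadic cylinders *)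

Section Thresholds.
Context (R : realType) (n : nat).
Notation grid := {ffun 'I_(2 ^ n) -> 'I_(4 ^ n).+1}.

(** The normalized mass that the grid point [l] gives to the indices below [j].  The
    denominator [4 ^ n] makes the rounding error [2 ^ n] of [sperner_grid]
    negligible. *)
Definition threshold (l : grid) (j : nat) : R :=
  (\sum_(i < 2 ^ n | (i < j)%N) l i)%:R / (4 ^ n)%:R.

Lemma threshold0 l : threshold l 0 = 0.
Proof. by rewrite /threshold big_pred0 ?mul0r. Qed.

Lemma le_threshold l i j : (i <= j)%N -> threshold l i <= threshold l j.
Proof.
move=> ij; rewrite ler_wpM2r ?invr_ge0// ler_nat.
rewrite [leqRHS](bigID (fun k : 'I_(2 ^ n) => (k < i)%N))/=.
rewrite (eq_bigl (fun k : 'I__ => (k < j)%N && (k < i)%N)) ?leq_addr// => k.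
by apply/idP/andP => [ki|[]//]; split=> //; exact: leq_trans ij.
Qed.

Lemma threshold_le_last l j : threshold l j <= threshold l (2 ^ n).
Proof.
have [/le_threshold//|/ltnW nj] := leqP j (2 ^ n).
rewrite /threshold (eq_bigl (fun i : 'I__ => (i < 2 ^ n)%N))// => i.
by rewrite ltn_ord (leq_trans (ltn_ord i) nj).
Qed.

Lemma threshold_ge0 l j : 0 <= threshold l j.
Proof. by rewrite -(threshold0 l) le_threshold. Qed.

(** The grid points found by [sperner_grid] have nearly equal thresholds, and give a
    mass of at most [2 ^- n] to any interval of indices without a colour of one of
    them. *)
Lemma sperner_thresholds (c : grid -> 'I_(2 ^ n)) :
  exists L : set grid,
  [/\ L !=set0,
      forall l, L l -> threshold l (2 ^ n) = 1,
      forall l l' j, L l -> L l' -> `|threshold l j - threshold l' j| <= 2 ^- n &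
      forall a b, (a <= b)%N -> (exists2 l, L l & (a <= c l < b)%N) \/
        forall l, L l -> threshold l b - threshold l a <= 2 ^- n].
Proof.
have pow_gt0 : (0 < 4 ^ n)%N by rewrite expn_gt0.
have [|L [m [L0 LP mN mc]]] := sperner_grid c.
  by rewrite expn_gt0 -[4%N]/(2 * 2)%N expnMn leq_pmulr ?expn_gt0.
have V : 2 ^- n = (2 ^ n)%:R / (4 ^ n)%:R :> R.
  have n0 : (2 ^ n)%:R != 0 :> R by rewrite pnatr_eq0 expn_eq0.
  by rewrite -[4%N]/(2 * 2)%N expnMn natrM invfM mulrA divff// mul1r natrX.
have close (P : pred 'I_(2 ^ n)) l : l \in L ->
    (\sum_(i | P i) m i <= \sum_(i | P i) l i <= \sum_(i | P i) m i + 2 ^ n)%N.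
  move=> /LP[lM ml]; rewrite leq_sum//=.
  have : (\sum_(i | ~~ P i) m i <= \sum_(i | ~~ P i) l i)%N by rewrite leq_sum.
  have := mN; rewrite (bigID P)/=; move: lM; rewrite (bigID P)/=; lia.
exists [set l | l \in L]; split.
- by have /finset.set0Pn[l lL] := L0; exists l.
- move=> l /= /LP[lM _]; rewrite /threshold (eq_bigl xpredT) ?lM; last first.
    by move=> i; rewrite ltn_ord.
  by rewrite divff// pnatr_eq0 -lt0n.
- move=> l l' j /= lL l'L; rewrite /threshold -mulrBl normrM.
  rewrite [X in _ * X]ger0_norm ?invr_ge0// V ler_wpM2r ?invr_ge0//.
  have := close (fun i => (i < j)%N) l lL; have := close (fun i => (i < j)%N) l' l'L.
  set x := (\sum_(_ | _) l _)%N; set y := (\sum_(_ | _) l' _)%N.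
  move=> xb yb; have xy : (x <= y + 2 ^ n)%N by lia.
  have yx : (y <= x + 2 ^ n)%N by lia.
  by move: xy yx; rewrite -!(ler_nat R) !natrD ler_norml; lra.
- move=> a b ab.
  have [[l [lL abl]]|nl] := pselect (exists l, l \in L /\ (a <= c l < b)%N).
    by left; exists l.
  right=> l /= lL; rewrite /threshold -mulrBl V ler_wpM2r ?invr_ge0//.
  rewrite lerBlDr -natrD ler_nat.
  rewrite (bigID (fun i : 'I__ => (i < a)%N))/= addnC leq_add//; last first.
    apply: eq_leq; apply: eq_bigl => i.
    by apply/andP/idP => [[]//|ia]; split=> //; exact: leq_trans ab.
  have /andP[_] := close (fun i => (i < b)%N && ~~ (i < a)%N) l lL.
  rewrite [X in (_ <= X + _)%N -> _]big1 ?add0n// => i /andP[ib ia].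
  have [//|[l' l'L cl']] := mc i; exfalso; apply: nl; exists l'; split=> //.
  by rewrite cl' ib leqNgt ia.
Qed.
End Thresholds.

Section Bits.
Implicit Types c : cantor_space.

(** The integer whose [n] binary digits are the first [n] terms of [c]. *)
Fixpoint dyadic_index n c : nat :=
  if n is k.+1 then ((dyadic_index k c).*2 + c k)%N else 0%N.

(** A point of the Cantor space starting with the [n] binary digits of [j].  The
    terms from the [n]-th on are irrelevant. *)
Definition expansion n (j : nat) : cantor_space :=
  fun i => odd (j %/ 2 ^ (n - i.+1)).

Lemma dyadic_index_lt n c : (dyadic_index n c < 2 ^ n)%N.
Proof. by elim: n => //= n IH; rewrite expnS; case: (c n); lia. Qed.

Lemma dyadic_index_expansion n k j : (k <= n)%N -> (j < 2 ^ n)%N ->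
  dyadic_index k (expansion n j) = (j %/ 2 ^ (n - k))%N.
Proof.
move=> + jn; elim: k => [|k IH] kn; first by rewrite subn0 divn_small.
rewrite /= IH ?(ltnW kn)// /expansion.
rewrite (_ : (n - k = (n - k.+1).+1)%N); last by lia.
rewrite expnSr divnMA divn2; lia.
Qed.

Lemma dyadic_index_div n k c : (k <= n)%N ->
  dyadic_index k c = (dyadic_index n c %/ 2 ^ (n - k))%N.
Proof.
elim: n k => [|n IH] k; first by rewrite leqn0 => /eqP->; rewrite divn1.
rewrite leq_eqVlt => /orP[/eqP->|]; first by rewrite subnn divn1.
rewrite ltnS => kn; rewrite subSn// expnS divnMA divn2/= (IH _ kn).
by congr (_ %/ _)%N; case: (c n); lia.
Qed.

Lemma eq_dyadic_index n c c' : dyadic_index n c = dyadic_index n c' ->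
  forall i, (i < n)%N -> c i = c' i.
Proof.
elim: n => // n IH /= e i; rewrite ltnS leq_eqVlt => /orP[/eqP->|].
  by move: e; case: (c n); case: (c' n) => //=; lia.
by apply: IH; move: e; case: (c n); case: (c' n) => //=; lia.
Qed.
End Bits.

Section Cells.
Context (R : realType).
Implicit Types (theta : nat -> R) (u : R).

(** The largest [j] below [2 ^ k] with [theta j <= u], or zero if there is none: the
    place of [u] among the thresholds [theta], of which [theta 0] is ignored. *)
Definition cell k theta u : nat := \max_(j < 2 ^ k | theta j <= u) j.

Lemma cell_lt k theta u : (cell k theta u < 2 ^ k)%N.
Proof.
rewrite -[X in (_ < X)%N]prednK ?expn_gt0// ltnS; apply/bigmax_leqP => j _.
by rewrite -ltnS prednK ?expn_gt0.
Qed.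

Lemma leq_cell k theta u j : {homo theta : i j / (i <= j)%N >-> i <= j} ->
  (0 < j < 2 ^ k)%N -> (j <= cell k theta u)%N = (theta j <= u).
Proof.
move=> mono /andP[j0 jk]; apply/idP/idP => [jc|ju].
  have [|i iu ci] := @eq_bigmax_cond _ (fun i : 'I_(2 ^ k) => theta i <= u) (@nat_of_ord _).
    rewrite lt0n; apply: contraTneq jc => /card0_eq none.
    by rewrite -ltnNge /cell big_pred0.
  by apply: le_trans iu; apply: mono; rewrite -ci.
exact: (@leq_bigmax_cond _ (fun i : 'I_(2 ^ k) => theta i <= u) _ (Ordinal jk)).
Qed.

Lemma cell_uniq k theta u a : {homo theta : i j / (i <= j)%N >-> i <= j} ->
  (a < 2 ^ k)%N ->
  (forall j, (0 < j < 2 ^ k)%N -> (j <= a)%N = (theta j <= u)) ->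
  cell k theta u = a.
Proof.
move=> mono ak aP; apply/eqP; rewrite eqn_leq; apply/andP; split.
  have [->//|c0] := posnP (cell k theta u).
  have ck : (0 < cell k theta u < 2 ^ k)%N by rewrite c0 cell_lt.
  by rewrite aP// -(leq_cell u mono ck).
have [->//|a0] := posnP a.
have ck : (0 < a < 2 ^ k)%N by rewrite a0.
by rewrite leq_cell// -aP.
Qed.

Lemma cell_coarse k n theta u : (k <= n)%N ->
  {homo theta : i j / (i <= j)%N >-> i <= j} ->
  cell k (fun j => theta (j * 2 ^ (n - k))%N) u = (cell n theta u %/ 2 ^ (n - k))%N.
Proof.
move=> kn mono; have nE : (2 ^ n = 2 ^ k * 2 ^ (n - k))%N by rewrite -expnD subnKC.
have p0 : (0 < 2 ^ (n - k))%N by rewrite expn_gt0.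
apply: cell_uniq.
- by move=> i j ij; apply: mono; rewrite leq_mul2r ij orbT.
- by rewrite ltn_divLR// -nE cell_lt.
- move=> j /andP[j0 jk]; rewrite leq_divRL// leq_cell// muln_gt0 j0 p0/=.
  by rewrite nE ltn_pmul2r.
Qed.

End Cells.

(** * Pointwise convergence *)

Section Convergence.
Context (R : realType).

(** Sequential compactness of a countable power of the unit interval.  The
    extracted subsequence tends to infinity but is not required to increase. *)
Lemma unit_cube_subseq (I : countType) (x : nat -> I -> R) :
  (forall n i, 0 <= x n i <= 1) ->
  exists (t : I -> R) (nu : nat -> nat), (forall m, (m <= nu m)%N) /\
    forall i, x (nu m) i @[m --> \oo] --> t i.
Proof.
move=> x01; pose Y : I -> topologicalType := fun=> R : topologicalType.
have cube : compact [set f : prod_topology Y | forall i, `[0, 1]%classic (f i)].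
  exact: (@tychonoff I Y (fun=> `[0, 1]%classic) (fun=> @segment_compact R 0 1)).
have PF : ProperFilter ((x : nat -> prod_topology Y) @ \oo).
  exact: fmap_proper_filter.
have [|t [_ xt]] := cube _ PF.
  by exists 0%N => // n _ i; rewrite /= in_itv/=; exact: x01.
pose near_at m k (f : I -> R) : bool :=
  if unpickle k is Some i then `|f i - t i| < m.+1%:R^-1 else true.
have near_t m : @nbhs _ (prod_topology Y) t
    [set f : prod_topology Y | forall k : 'I_m.+1, near_at m k f].
  apply: (@filter_forall (prod_topology Y) 'I_m.+1 (fun k f => near_at m k f)
    (nbhs (t : prod_topology Y)) (nbhs_filter _)) => k.
  rewrite /near_at; case: unpickle => [i|]; last exact: filterE.
  have em : 0 < m.+1%:R^-1 :> R by [].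
  apply: (@filterS (prod_topology Y) (nbhs (t : prod_topology Y)) _
    (proj i @^-1` ball (t i : R) m.+1%:R^-1)); last first.
    exact: (@proj_continuous I Y i t _ (nbhsx_ballx (t i : R) m.+1%:R^-1 em)).
  by move=> f; rewrite /preimage/= /proj -ball_normE/= distrC.
have /choice[nu nuP] : forall m, exists n,
    (m <= n)%N /\ forall k : 'I_m.+1, near_at m k (x n).
  move=> m; have [|_ [[n /= mn <-] P]] :=
      xt [set x n | n in [set n | (m <= n)%N]] _ _ (near_t m).
    by exists m => // n mn; exists n.
  by exists n.
exists t, nu; split=> [m|i]; first by have [] := nuP m.
apply/cvgrPdist_lt => e e0; near=> m.
have im : (pickle i < m.+1)%N by rewrite ltnS; near: m; exact: nbhs_infty_ge.
have [_ /(_ (Ordinal im))] := nuP m; rewrite /near_at/= pickleK distrC => /lt_trans; apply.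
by near: m; exact: near_infty_natSinv_lt (PosNum e0).
Unshelve. all: by end_near. Qed.

Lemma ptws_cvgP (U : Type) (T : topologicalType) (u : nat -> {ptws U -> T})
    (f : {ptws U -> T}) :
  (forall s, u n s @[n --> \oo] --> f s) -> u @ \oo --> f.
Proof.
move=> uf; apply/cvg_sup => s A /= [_ [[B Bop <-] Bfs BA]].
by apply: filterS BA _; apply: uf; exact: open_nbhs_nbhs.
Qed.

Lemma cantor_cvg (c : nat -> cantor_space) (c0 : cantor_space) :
  (forall k, \forall n \near \oo, dyadic_index k (c n) = dyadic_index k c0) ->
  c @ \oo --> c0.
Proof.
move=> H; apply: ptws_cvgP => i; apply: cvg_near_cst.
by near=> n; apply: (@eq_dyadic_index i.+1) => //; near: n; exact: H.
Unshelve. all: by end_near. Qed.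

End Convergence.

(** * Fixed points of decomposable mappings *)

(** A decomposable set contains the functions obtained by selecting, on each level
    set of [a], one of finitely many of its members. *)
Lemma decomposable_select (d : measure_display) (S : measurableType d)
    (T : topologicalType) (G : set {ptws S -> T}) (a : S -> nat) (N : nat)
    (g : nat -> {ptws S -> T}) :
  decomposable G -> (forall k, measurable [set s | (k < a s)%N]) ->
  (forall s, a s <= N)%N -> (forall k, (k <= N)%N -> G (g k)) ->
  G (fun s => g (a s) s).
Proof.
move=> decG ma aN Gg.
suff H k : (k <= N)%N -> G (fun s => g (minn (a s) k) s).
  by have := H N (leqnn N); congr G; apply/funext => s; rewrite (minn_idPl _).
elim: k => [|k IH] kN.
  by have := Gg 0%N kN; congr G; apply/funext => s; rewrite minn0.
have := decG _ _ _ (ma k) (IH (ltnW kN)) (Gg _ kN).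
congr G; apply/funext => s; rewrite /patch; case: ifPn.
  by rewrite inE /= => ka; rewrite (minn_idPr _).
rewrite notin_setE /= => /negP; rewrite -leqNgt => ak.
by rewrite !(minn_idPl _) ?(leq_trans ak)//.
Qed.

Lemma cvg_pair_seq (Y Z : topologicalType) (u : nat -> Y) (v : nat -> Z)
    (a : Y) (b : Z) :
  u @ \oo --> a -> v @ \oo --> b -> (fun n => (u n, v n)) @ \oo --> (a, b).
Proof. by move=> ua vb; exact: (cvg_pair ua vb). Qed.

Section FixedPoint.
Context (R : realType) (d : measure_display) (S : measurableType d).
Context (mu : probability S R) (T : topologicalType).
Context (F : set {ptws S -> T}) (B : {ptws S -> T} -> set {ptws S -> T}).
Context (q : cantor_space -> {ptws S -> T}) (U : S -> R).
Hypothesis BD : decomposable_mapping F B.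
Hypothesis BC : mu_seq_closed_graphed mu F B.
Hypothesis q_cts : continuous q.
Hypothesis Fq : forall c, F (q c).
Hypothesis Bq : forall f, F f -> exists c, B f (q c).
Hypothesis U01 : forall s, 0 <= U s <= 1.
Hypothesis mU : forall t, measurable [set s | U s < t].
Hypothesis U_null : forall t, mu.-negligible [set s | U s = t].

Lemma measurable_cell k (theta : nat -> R) j :
  {homo theta : i j / (i <= j)%N >-> i <= j} ->
  measurable [set s | (j < cell k theta (U s))%N].
Proof.
move=> mono; have [jk|jk] := ltnP j.+1 (2 ^ k).
  have -> : [set s | (j < cell k theta (U s))%N] = ~` [set s | U s < theta j.+1].
    by apply/seteqP; split=> s /=; rewrite leq_cell// leNgt => /negP.
  exact: measurableC.
suff -> : [set s | (j < cell k theta (U s))%N] = set0 by exact: measurable0.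
rewrite -subset0 => s /=; apply/negP; rewrite -leqNgt -ltnS.
exact: leq_trans (cell_lt _ _ _) jk.
Qed.

Lemma cell_select (G : set {ptws S -> T}) k (theta : nat -> R) (g : nat -> {ptws S -> T}) :
  decomposable G -> {homo theta : i j / (i <= j)%N >-> i <= j} ->
  (forall j, (j < 2 ^ k)%N -> G (g j)) -> G (fun s => g (cell k theta (U s)) s).
Proof.
move=> decG mono Gg; apply: (@decomposable_select _ _ _ G (fun s => cell k theta (U s)) (2 ^ k).-1) => //.
- by move=> j; exact: measurable_cell.
- by move=> s; rewrite -ltnS prednK ?expn_gt0// cell_lt.
- by move=> j; rewrite -ltnS prednK ?expn_gt0//; exact: Gg.
Qed.

(** The simple function attached to a grid point [l]: the point of [S] whose value
    under [U] lies in the [j]-th threshold interval of [l] takes the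
    value there of [q c], for a [c] in the [j]-th cylinder of depth [n]. *)
Definition step_fun n (l : {ffun 'I_(2 ^ n) -> 'I_(4 ^ n).+1}) : {ptws S -> T} :=
  fun s => q (expansion n (cell n (threshold R l) (U s))) s.

Lemma F_step_fun n l : F (@step_fun n l).
Proof.
have [decF _ _] := BD.
apply: (@cell_select F n _ (fun j => q (expansion n j))) => // i j.
exact: le_threshold.
Qed.

Lemma q_cvg (c : nat -> cantor_space) (c0 : cantor_space) :
  (forall k, \forall n \near \oo, dyadic_index k (c n) = dyadic_index k c0) ->
  (fun n => q (c n)) @ \oo --> q c0.
Proof. by move=> /cantor_cvg cc; apply: continuous_cvg => //; exact: q_cts. Qed.

Lemma eval_cvg (u : nat -> {ptws S -> T}) (f : {ptws S -> T}) s :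
  u @ \oo --> f -> u n s @[n --> \oo] --> f s.
Proof.
move=> uf; apply: (@cvg_comp _ _ _ u (fun h : {ptws S -> T} => h s) _ _ _ uf).
exact: (@proj_continuous S (fun=> T) s f).
Qed.

Lemma cantor_subseq (c : nat -> cantor_space) :
  exists c0 (nu : nat -> nat), (forall m, (m <= nu m)%N) /\
    forall k, \forall n \near \oo, dyadic_index k (c (nu n)) = dyadic_index k c0.
Proof.
have [|t [nu [nuP cvg_t]]] := @unit_cube_subseq R nat (fun n i => (c n i)%:R).
  by move=> n i; case: (c n i) => /=; rewrite lexx ler01.
exists (fun i => 2^-1 < t i), nu; split=> //.
elim=> [|k IH] /=; first exact: nearW.
have /cvgrPdist_lt/(_ 4^-1 ltac:(by [])) near_t := cvg_t k.
near=> n; rewrite (near IH n)//; congr (_ + nat_of_bool _)%N.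
have : `|t k - (c (nu n) k)%:R| < 4^-1 by near: n; exact: near_t.
rewrite ltr_norml; case: (c (nu n) k) => /= /andP[? ?]; apply/esym.
  by lra.
by apply/negbTE; rewrite -leNgt; lra.
Unshelve. all: by end_near. Qed.

Lemma le_close (u v w z a b : R) : b < `|u - z| / 2 -> a <= b ->
  `|v - w| <= a -> `|z - w| < `|u - z| / 2 -> (v <= u) = (z <= u).
Proof.
move=> bz ab vw zw; have : `|v - z| < `|u - z|.
  have : `|v - z| <= `|v - w| + `|z - w| by rewrite [`|z - w|]distrC ler_distD.
  lra.
by rewrite ltr_norml; case: (ger0P (u - z)) => [?|?] /andP[? ?]; apply/idP/idP; lra.
Qed.

Lemma near_exp2V (e : R) : 0 < e -> \forall m \near \oo, 2 ^- m < e.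
Proof.
move=> e0; have [n ne] := exp2V_small 2 e0; near=> m.
have nm : (n <= m)%N by near: m; exact: nbhs_infty_ge.
have : 2 ^- m <= 2 ^- n :> R by rewrite lef_pV2 ?posrE ?exprn_gt0// ler_eXn2l// ltr1n.
have : 0 < 2 ^- n :> R by rewrite invr_gt0 exprn_gt0.
lra.
Unshelve. all: by end_near. Qed.

Theorem decomposable_fixed_point : exists2 f, F f & B f f.
Proof.
have [decF BF decB] := BD; have [Bnull Fclosed Gclosed] := BC.
pose grid n := {ffun 'I_(2 ^ n) -> 'I_(4 ^ n).+1}.
have /choice[g gP] : forall nl : {n & grid n}, exists c, B (step_fun (projT2 nl)) (q c).
  by move=> [n l]; apply/Bq/F_step_fun.
(* [gam n l] is a label for [l]: [q (gam n l)] is a value of [B] at its step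
   function. *)
pose gam n (l : grid n) := g (existT _ n l).
have Bgam n (l : grid n) : B (step_fun l) (q (gam n l)) by exact: (gP (existT _ n l)).
have spn n := sperner_thresholds R
  (fun l : grid n => Ordinal (dyadic_index_lt n (gam n l))).
pose L n : set (grid n) := projT1 (cid (spn n)).
have L_last n l : L n l -> threshold R l (2 ^ n) = 1.
  by rewrite /L; case: cid => ? /= [_ + _ _]; exact.
have L_close n l l' j : L n l -> L n l' -> `|threshold R l j - threshold R l' j| <= 2 ^- n.
  by rewrite /L; case: cid => ? /= [_ _ + _]; exact.
have L_block n a b : (a <= b)%N ->
    (exists2 l, L n l & (a <= dyadic_index n (gam n l) < b)%N) \/
    forall l, L n l -> threshold R l b - threshold R l a <= 2 ^- n.
  by rewrite /L; case: cid => ? /= [_ _ _ +]; exact.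
have L0 n : exists l, L n l by rewrite /L; case: cid => ? /= [[l ?] _ _ _]; exists l.
pose lam n : grid n := projT1 (cid (L0 n)).
have Llam n : L n (lam n) by rewrite /lam; case: cid.
clearbody L lam.
(* The [j]-th threshold at the coarser level [k]; it is meaningful for [k <= n]. *)
pose x n (kj : nat * nat) := threshold R (lam n) (kj.2 * 2 ^ (n - kj.1)).
have [|t [nu [nuP xt]]] := @unit_cube_subseq R (nat * nat)%type x.
  by move=> n kj; rewrite threshold_ge0 -(L_last _ _ (Llam n)) threshold_le_last.
have nu_infty k : \forall m \near \oo, (k <= nu m)%N.
  near=> m; apply: leq_trans (nuP m); near: m; exact: nbhs_infty_ge.
have t0 k : t (k, 0%N) = 0.
  apply: (cvg_unique (@Rhausdorff R) (xt (k, 0%N))).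
  by apply: cvg_near_cst; apply: nearW => m; rewrite /x mul0n threshold0.
have t1 k : t (k, 2 ^ k)%N = 1.
  apply: (cvg_unique (@Rhausdorff R) (xt (k, 2 ^ k)%N)).
  apply: cvg_near_cst; near=> m; rewrite /x/= -expnD subnKC ?L_last//.
  by near: m; exact: nu_infty.
have t_mono k : {homo (fun j => t (k, j)) : i j / (i <= j)%N >-> i <= j}.
  move=> i j ij; apply: (ler_cvg_to (xt (k, i)) (xt (k, j))); apply: nearW => m.
  by apply: le_threshold; rewrite leq_mul2r/= ij orbT.
have t_refine k j : t (k, j) = t (k.+1, j * 2)%N.
  apply: (cvg_unique (@Rhausdorff R) _ (xt (k.+1, j * 2)%N)).
  apply: cvg_trans (xt (k, j)); apply: near_eq_cvg; near=> m; rewrite /x/=.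
  have km : (k.+1 <= nu m)%N by near: m; exact: nu_infty.
  by rewrite -mulnA -expnS -subSn.
(* [c s] is the branch of the Cantor tree selected by the limit thresholds. *)
pose A k s := cell k (fun j => t (k, j)) (U s).
pose c s : cantor_space := fun k => odd (A k.+1 s).
have idx_c k s : dyadic_index k (c s) = A k s.
  elim: k => [|k IH] /=.
    by have := cell_lt 0 (fun j => t (0%N, j)) (U s); rewrite /A; case: cell.
  rewrite IH /c /A; have := cell_coarse (U s) (leqnSn k) (t_mono k.+1).
  rewrite subSnn expn1 divn2; under eq_fun do rewrite -t_refine.
  by move=> ->; rewrite addnC odd_double_half.
(* Outside [NE] no value of [U] is a limit threshold; on [NE] every function is
   replaced with [qd]. *)
have [NE [mNE NE0 sub_NE]] : mu.-negligible
    (\bigcup_i if unpickle i is Some kj then [set s | U s = t kj] else set0).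
  apply: negligible_bigcup => i; case: unpickle => [kj|]; first exact: U_null.
  exact: negligible_set0.
have neqU s kj : ~ NE s -> U s != t kj.
  move=> nEs; apply/eqP => Us; apply/nEs/sub_NE.
  by exists (pickle kj) => //; rewrite pickleK.
pose qd := q (fun=> false).
pose glue (h : {ptws S -> T}) : {ptws S -> T} := patch h NE qd.
pose f := glue (fun s => q (c s) s).
have cvg_glue (u : nat -> {ptws S -> T}) (h : {ptws S -> T}) :
    (forall s, ~ NE s -> u n s @[n --> \oo] --> h s) ->
    (fun n => glue (u n)) @ \oo --> glue h.
  move=> uh; apply: ptws_cvgP => s; rewrite /glue /patch; case: ifPn.
    by move=> _; exact: cvg_cst.
  by rewrite notin_setE; exact: uh.
have F_glue h : F h -> F (glue h) by move=> Fh; apply: decF => //; exact: Fq.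
have cvg_step (nu' : nat -> nat) (l : forall m, grid (nu' m)) :
    (forall m, (m <= nu' m)%N) -> (forall kj, x (nu' m) kj @[m --> \oo] --> t kj) ->
    (forall m, L (nu' m) (l m)) ->
    (fun m => glue (step_fun (l m))) @ \oo --> f.
  move=> nuP' xt' Ll; apply: cvg_glue => s nEs.
  apply: (@eval_cvg (fun m => q _)); apply: q_cvg => k; rewrite idx_c.
  have near_k : \forall m \near \oo, forall j : 'I_(2 ^ k),
      (threshold R (l m) (j * 2 ^ (nu' m - k)) <= U s) = (t (k, nat_of_ord j) <= U s).
    apply: filter_forall => j; have := neqU s (k, nat_of_ord j) nEs.
    rewrite -subr_eq0 -normr_gt0 => e0.
    have e2 : 0 < `|U s - t (k, nat_of_ord j)| / 2 by rewrite divr_gt0.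
    have /cvgrPdist_lt/(_ _ e2) near_x := xt' (k, nat_of_ord j).
    near=> m.
    apply: (@le_close _ _ (x (nu' m) (k, nat_of_ord j)) _ (2 ^- nu' m) (2 ^- m)).
    - by near: m; exact: near_exp2V.
    - by rewrite lef_pV2 ?posrE ?exprn_gt0// ler_eXn2l ?nuP' ?ltr1n.
    - exact: L_close.
    - by near: m.
  near=> m.
  have km : (k <= nu' m)%N.
    by apply: leq_trans (nuP' m); near: m; exact: nbhs_infty_ge.
  rewrite dyadic_index_expansion ?cell_lt// -cell_coarse//; last first.
    by move=> i j; exact: le_threshold.
  apply: cell_uniq; first 2 last.
  - move=> j /[dup] j0k /andP[_ jk]; rewrite /A (leq_cell _ (t_mono k) j0k).
    by have -> := near near_k m _ (Ordinal jk).
  - by move=> i j ij; apply: le_threshold; rewrite leq_mul2r ij orbT.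
  - exact: cell_lt.
have Ff : F f.
  apply: (Fclosed (fun m => glue (step_fun (lam (nu m))))) => //.
    by move=> m; apply/F_glue/F_step_fun.
  exact: cvg_step.
have graph_glue (h h' : {ptws S -> T}) : B h h' -> F h -> B (glue h) h'.
  by move=> hh' Fh; have [] := Bnull NE h h' qd mNE NE0 Fh hh' (Fq _).
(* A dyadic interval of positive limit mass contains labels of step functions
   tending to [f], hence a limit label, which belongs to [B f]. *)
have Bq_block k j : (j < 2 ^ k)%N -> t (k, j) < t (k, j.+1) ->
    exists c1, dyadic_index k c1 = j /\ B f (q c1).
  move=> jk tj; pose e := t (k, j.+1) - t (k, j); have e0 : 0 < e / 3.
    by rewrite divr_gt0// subr_gt0.
  have /cvgrPdist_lt/(_ _ e0) near1 := xt (k, j.+1).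
  have /cvgrPdist_lt/(_ _ e0) near0 := xt (k, j).
  have : \forall m \near \oo, exists2 l, L (nu m) l & dyadic_index k (gam (nu m) l) = j.
    near=> m.
    have km : (k <= nu m)%N by near: m; exact: nu_infty.
    have [|[l Ll /andP[jl lj]]|small] :=
      L_block (nu m) (j * 2 ^ (nu m - k))%N (j.+1 * 2 ^ (nu m - k))%N.
    - by rewrite leq_mul2r leqnSn orbT.
    - exists l => //; rewrite (dyadic_index_div _ km).
      have p0 : (0 < 2 ^ (nu m - k))%N by rewrite expn_gt0.
      by apply/eqP; rewrite eqn_leq leq_divRL// jl -ltnS ltn_divLR// lj.
    - exfalso; have := small _ (Llam _).
      rewrite -/(x (nu m) (k, j)) -/(x (nu m) (k, j.+1)).
      have : `|t (k, j.+1) - x (nu m) (k, j.+1)| < e / 3 by near: m.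
      have : `|t (k, j) - x (nu m) (k, j)| < e / 3 by near: m.
      have : 2 ^- m < e / 3 by near: m; exact: near_exp2V.
      have : 2 ^- nu m <= 2 ^- m :> R.
        by rewrite lef_pV2 ?posrE ?exprn_gt0// ler_eXn2l ?nuP ?ltr1n.
      rewrite /e !ltr_norml; lra.
  move=> near_l.
  have lP m : exists l, L (nu m) l /\
      ((exists2 l, L (nu m) l & dyadic_index k (gam (nu m) l) = j) ->
       dyadic_index k (gam (nu m) l) = j).
    have [[l Ll lj]|nl] := pselect (exists2 l, L (nu m) l & dyadic_index k (gam (nu m) l) = j).
      by exists l.
    by exists (lam (nu m)).
  pose l m := projT1 (cid (lP m)).
  have Ll m : L (nu m) (l m) by rewrite /l; case: cid => ? [].
  have lj : \forall m \near \oo, dyadic_index k (gam (nu m) (l m)) = j.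
    by apply: filterS near_l => m; rewrite /l; case: cid => ? [].
  clearbody l.
  have [c1 [nu' [nuP' c1P]]] := cantor_subseq (fun m => gam (nu m) (l m)).
  have nu'_infty : nu' @ \oo --> \oo.
    move=> P [N _ NP]; exists N => // m /= Nm; apply: NP => /=.
    exact: leq_trans (nuP' m).
  exists c1; split.
    have [m [<- <-]] := filter_ex (filterI (c1P k) (nu'_infty _ lj)).
    by [].
  suff [] : graph_on F B (f, q c1) by [].
  apply: (Gclosed (fun m => (glue (step_fun (l (nu' m))), q (gam _ (l (nu' m)))))).
  - by move=> m; split; [exact/F_glue/F_step_fun|exact/graph_glue/F_step_fun].
  - by split=> //=; exact: Fq.
  - apply: cvg_pair_seq; last exact: q_cvg.
    apply: (cvg_step (fun m => nu (nu' m)) (fun m => l (nu' m))) => //.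
      by move=> m; exact: leq_trans (nuP _).
    by move=> kj; exact: (cvg_comp _ _ nu'_infty (xt kj)).
have [cf Bcf] := Bq Ff.
have /choice[kap kapP] : forall kj : nat * nat, exists c1, B f (q c1) /\
    ((kj.2 < 2 ^ kj.1)%N -> t kj < t (kj.1, kj.2.+1) -> dyadic_index kj.1 c1 = kj.2).
  move=> [k j] /=.
  have [[jk tj]|nj] := pselect ((j < 2 ^ k)%N /\ t (k, j) < t (k, j.+1)).
    by have [c1 [c1j Bc1]] := Bq_block k j jk tj; exists c1.
  by exists cf; split=> // jk tj; exfalso; apply: nj.
(* [h k] assembles finitely many such labels, following the branch of [f] down to
   level [k]. *)
pose h k : {ptws S -> T} := glue (fun s => q (kap (k, A k s)) s).
have Bh k : B f (h k).
  have [|+ _] := Bnull NE f (fun s => q (kap (k, A k s)) s) qd mNE NE0 Ff _ (Fq _).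
    apply: (@cell_select _ k _ (fun j => q (kap (k, j)))) => //; first exact: decB.
    by move=> j _; have [] := kapP (k, j).
  exact.
(* Off [NE], only intervals of positive limit mass are visited. *)
have tA k s : ~ NE s -> t (k, A k s) < t (k, (A k s).+1).
  move=> nEs; have /andP[U0 U1] := U01 s.
  have cellE j : (0 < j < 2 ^ k)%N -> (j <= A k s)%N = (t (k, j) <= U s).
    by move=> jk; rewrite /A (leq_cell _ (t_mono k) jk).
  apply: (@le_lt_trans _ _ (U s)).
    have [->|A0] := posnP (A k s); first by rewrite t0.
    by rewrite -cellE// A0 cell_lt.
  have [A1|A1] := ltnP (A k s).+1 (2 ^ k).
    by rewrite ltNge -cellE// -ltnNge.
  have -> : (A k s).+1 = (2 ^ k)%N by apply/eqP; rewrite eqn_leq A1 cell_lt.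
  by rewrite t1 lt_neqAle U1 -(t1 0%N) neqU.
exists f => //.
suff [] : graph_on F B (f, f) by [].
apply: (Gclosed (fun k => (f, h k))).
- by move=> k; split => //; exact: Bh.
- by [].
- apply: cvg_pair_seq; first exact: cvg_cst.
  apply: cvg_glue => s nEs; apply: (@eval_cvg (fun k => q _)); apply: q_cvg => k0.
  near=> k; have k0k : (k0 <= k)%N by near: k; exact: nbhs_infty_ge.
  rewrite (dyadic_index_div _ k0k) (dyadic_index_div _ k0k) idx_c.
  by have [_ /= ->] := kapP (k, A k s); rewrite ?cell_lt ?tA.
Unshelve. all: by end_near. Qed.
End FixedPoint.

Theorem corollary2p3 (R : realType) (d : measure_display)
    (S : measurableType d) (mu : probability S R) (T : topologicalType)
    (F : set {ptws S -> T}) (B : {ptws S -> T} -> set {ptws S -> T})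
    (X : set {ptws S -> T}) :
  atomless mu ->
  [set: T] !=set0 ->
  decomposable_mapping F B ->
  mu_seq_closed_graphed mu F B ->
  X !=set0 -> X `<=` F -> compact X -> metrizable R (set_type X) ->
  (forall f, F f -> X `&` B f !=set0) ->
  exists2 f, F f & B f f.
Proof.
move=> atom _ BD BC X0 XF cX mX hit.
have [U [U01 mU U_null]] := diffuse_function atom.
have [q [q_cts qX]] := cantor_parametrization X0 cX mX.
apply: (decomposable_fixed_point BD BC q_cts _ _ U01 mU U_null).
  by move=> c; apply: XF; rewrite -qX; exists c.
by move=> f /hit[x []]; rewrite -qX => -[c _ <-] Bf; exists c.
Qed.
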